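(* Let $K$ be a field of characteristic different from $2$ and let $a,b,c,d\in K$ satisfy the non-degeneracy condition stated in the context. Let $\mathcal{K}^{\mathrm{gen}}(\mathcal{D})\subset\mathbf{P}^3$ (coordinates $k_1,k_2,k_3,k_4$) be the General Kummer surface of the genus $2$ curve $\mathcal{D}: y^2=x(x-1)(x-\rho)(x-\sigma)(x-\tau)$, let $\mathcal{K}^{\mathrm{fast}}\subset\mathbf{P}^3$ (coordinates $X,Y,Z,T$) be the Fast Kummer surface with parameters $a,b,c,d$, and let $P$ be the $4\times4$ matrix over $K$, all as defined in the context. Then the map $$\begin{pmatrix} X \\ Y \\ Z \\ T \end{pmatrix}=P^{-1}\begin{pmatrix} k_1 \\ k_2 \\ k_3 \\ k_4 \end{pmatrix}$$ is a linear map from $\mathcal{K}^{\mathrm{gen}}(\mathcal{D})$ to $\mathcal{K}^{\mathrm{fast}}$.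
   Context: **Parameters.** For $a,b,c,d\in K$ put $A=a^2+b^2+c^2+d^2$, $B=a^2+b^2-c^2-d^2$, $C=a^2-b^2+c^2-d^2$, $D=a^2-b^2-c^2+d^2$, and $$E=\frac{abcd\,ABCD}{(a^2d^2-b^2c^2)(a^2c^2-b^2d^2)(a^2b^2-c^2d^2)},\quad F=\frac{a^4-b^4-c^4+d^4}{a^2d^2-b^2c^2},$$ $$G=\frac{a^4-b^4+c^4-d^4}{a^2c^2-b^2d^2},\quad H=\frac{a^4+b^4-c^4-d^4}{a^2b^2-c^2d^2}.$$ **Curve $\mathcal{D}$.** $\mathcal{D}: y^2=x(x-1)(x-\rho)(x-\sigma)(x-\tau)$ with $$\rho=\frac{CD}{AB},\quad \sigma=\frac{(ac+bd)C}{(ac-bd)A},\quad \tau=\frac{(ac+bd)D}{(ac-bd)B}.$$ Non-degeneracy condition: these quantities are defined (i.e. $A,B,ac-bd\neq0$) and $\infty,0,1,\rho,\sigma,\tau$ are pairwise distinct, so that $\mathcal{D}$ has genus $2$. **Fast Kummer surface.** $\mathcal{K}^{\mathrm{fast}}$ is $$X^4+Y^4+Z^4+T^4-F(X^2T^2+Y^2Z^2)-G(X^2Z^2+Y^2T^2)-H(X^2Y^2+Z^2T^2)+2E\,XYZT=0.$$ **General Kummer surface.** For a genus $2$ curve $y^2=f_6x^6+f_5x^5+\dots+f_1x+f_0$, the General Kummer surface is the quartic in $\mathbf{P}^3$ $$F_1k_4^2+F_2k_4+F_3=0,$$ where $F_1=k_2^2-4k_1k_3$, $F_2=-2(2k_1^3f_0+k_1^2k_2f_1+2k_1^2k_3f_2+k_1k_2k_3f_3+2k_1k_3^2f_4+k_2k_3^2f_5+2k_3^3f_6)$,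 $F_3=-4k_1^4f_0f_2+k_1^4f_1^2-4k_1^3k_2f_0f_3-2k_1^3k_3f_1f_3-4k_1^2k_2^2f_0f_4+4k_1^2k_2k_3f_0f_5-4k_1^2k_2k_3f_1f_4-4k_1^2k_3^2f_0f_6+2k_1^2k_3^2f_1f_5-4k_1^2k_3^2f_2f_4+k_1^2k_3^2f_3^2-4k_1k_2^3f_0f_5+8k_1k_2^2k_3f_0f_6-4k_2^4f_0f_6-4k_1k_2^2k_3f_1f_5+4k_1k_2k_3^2f_1f_6-4k_1k_2k_3^2f_2f_5-2k_1k_3^3f_3f_5-4k_2^3k_3f_1f_6-4k_2^2k_3^2f_2f_6-4k_2k_3^3f_3f_6-4k_3^4f_4f_6+k_3^4f_5^2$. $\mathcal{K}^{\mathrm{gen}}(\mathcal{D})$ is this surface with $f_6=0$ and $f_0,\dots,f_5$ the coefficients of $x(x-1)(x-\rho)(x-\sigma)(x-\tau)$. **Matrix $P$.** Put $n_1=ac-bd$, $n_2=ac+bd$, $m_1=c^2(a^4+b^4-c^4+d^4)-2a^2b^2d^2$, $m_2=d^2(a^4+b^4+c^4-d^4)-2a^2b^2c^2$, $m_3=a^2(a^4-b^4-c^4-d^4)+2b^2c^2d^2$, $m_4=b^2(a^4-b^4+c^4+d^4)-2a^2c^2d^2$, and $$P=\begin{pmatrix} c n_1^2A^2B^2 & -d n_1^2A^2B^2 & -a n_1^2A^2B^2 & b n_1^2A^2B^2 \\ 2a n_1AB m_1 & 2b n_1AB m_2 & -2c n_1AB m_3 & 2d n_1AB m_4 \\ c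 n_1n_2ABCD & d n_1n_2ABCD & -a n_1n_2ABCD & -b n_1n_2ABCD \\ 2a n_2CD m_1 & -2b n_2CD m_2 & -2c n_2CD m_3 & -2d n_2CD m_4 \end{pmatrix}.$$ That the displayed map ''is a linear map from $\mathcal{K}^{\mathrm{gen}}(\mathcal{D})$ to $\mathcal{K}^{\mathrm{fast}}$'' means that this linear change of coordinates on $\mathbf{P}^3$ converts the defining equation of $\mathcal{K}^{\mathrm{gen}}(\mathcal{D})$ into that of $\mathcal{K}^{\mathrm{fast}}$ (up to a nonzero constant factor). *)

(* Defs.v *)
From mathcomp Require Import all_boot all_algebra.
From mathcomp Require Import mpoly.

Set Implicit Arguments.
Unset Strict Implicit.
Unset Printing Implicit Defensive.

Import GRing.Theory.
Local Open Scope ring_scope.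

Section FastKummer.

Variables (K : fieldType) (a b c d : K).

Definition parA : K := a ^+ 2 + b ^+ 2 + c ^+ 2 + d ^+ 2.
Definition parB : K := a ^+ 2 + b ^+ 2 - c ^+ 2 - d ^+ 2.
Definition parC : K := a ^+ 2 - b ^+ 2 + c ^+ 2 - d ^+ 2.
Definition parD : K := a ^+ 2 - b ^+ 2 - c ^+ 2 + d ^+ 2.

(* The denominators of parE, parF, parG and parH are not assumed to be
   nonzero: this follows from nondegenerate_params below in characteristic other
   than 2, because sigma, sigma - 1, tau - 1 and rho - sigma are nonzero. *)
Definition parE : K :=
  (a * b * c * d * parA * parB * parC * parD) /
  ((a ^+ 2 * d ^+ 2 - b ^+ 2 * c ^+ 2) * (a ^+ 2 * c ^+ 2 - b ^+ 2 * d ^+ 2) *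
   (a ^+ 2 * b ^+ 2 - c ^+ 2 * d ^+ 2)).
Definition parF : K :=
  (a ^+ 4 - b ^+ 4 - c ^+ 4 + d ^+ 4) / (a ^+ 2 * d ^+ 2 - b ^+ 2 * c ^+ 2).
Definition parG : K :=
  (a ^+ 4 - b ^+ 4 + c ^+ 4 - d ^+ 4) / (a ^+ 2 * c ^+ 2 - b ^+ 2 * d ^+ 2).
Definition parH : K :=
  (a ^+ 4 + b ^+ 4 - c ^+ 4 - d ^+ 4) / (a ^+ 2 * b ^+ 2 - c ^+ 2 * d ^+ 2).

Definition n1 : K := a * c - b * d.
Definition n2 : K := a * c + b * d.

Definition rho : K := (parC * parD) / (parA * parB).
Definition sigma : K := (n2 * parC) / (n1 * parA).
Definition tau : K := (n2 * parD) / (n1 * parB).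

(* The sixth branch point, infinity, is distinct from the other five because
   those are elements of K. *)
Definition nondegenerate_params : bool :=
  [&& parA != 0, parB != 0, n1 != 0 & uniq [:: 0; 1; rho; sigma; tau]].

(* The curve D is y ^ 2 = curveD_poly(x). *)
Definition curveD_poly : {poly K} :=
  'X * ('X - 1) * ('X - rho%:P) * ('X - sigma%:P) * ('X - tau%:P).

Definition m1 : K :=
  c ^+ 2 * (a ^+ 4 + b ^+ 4 - c ^+ 4 + d ^+ 4) - 2 * a ^+ 2 * b ^+ 2 * d ^+ 2.
Definition m2 : K :=
  d ^+ 2 * (a ^+ 4 + b ^+ 4 + c ^+ 4 - d ^+ 4) - 2 * a ^+ 2 * b ^+ 2 * c ^+ 2.
Definition m3 : K :=
  a ^+ 2 * (a ^+ 4 - b ^+ 4 - c ^+ 4 - d ^+ 4) + 2 * b ^+ 2 * c ^+ 2 * d ^+ 2.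
Definition m4 : K :=
  b ^+ 2 * (a ^+ 4 - b ^+ 4 + c ^+ 4 + d ^+ 4) - 2 * a ^+ 2 * c ^+ 2 * d ^+ 2.

Definition matP_rows : seq (seq K) :=
  let A := parA in let B := parB in let C := parC in let D := parD in
  [:: [:: c * n1 ^+ 2 * A ^+ 2 * B ^+ 2; - d * n1 ^+ 2 * A ^+ 2 * B ^+ 2;
          - a * n1 ^+ 2 * A ^+ 2 * B ^+ 2; b * n1 ^+ 2 * A ^+ 2 * B ^+ 2];
      [:: 2 * a * n1 * A * B * m1; 2 * b * n1 * A * B * m2;
          - 2 * c * n1 * A * B * m3; 2 * d * n1 * A * B * m4];
      [:: c * n1 * n2 * A * B * C * D; d * n1 * n2 * A * B * C * D;
          - a * n1 * n2 * A * B * C * D; - b * n1 * n2 * A * B * C * D];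
      [:: 2 * a * n2 * C * D * m1; - 2 * b * n2 * C * D * m2;
          - 2 * c * n2 * C * D * m3; - 2 * d * n2 * C * D * m4]].

Definition matP : 'M[K]_4 :=
  \matrix_(i < 4, j < 4) nth 0 (nth [::] matP_rows i) j.

End FastKummer.

(* Quartic surfaces in P^3 are represented by their defining polynomials. The
   four homogeneous coordinates are the variables of index 0, 1, 2 and 3. *)
Definition proj_coord (K : fieldType) (i : nat) : {mpoly K[4]} :=
  'X_(inord i : 'I_4).

Definition kummer_fast (K : fieldType) (a b c d : K) : {mpoly K[4]} :=
  let X := proj_coord K 0 in let Y := proj_coord K 1 in
  let Z := proj_coord K 2 in let T := proj_coord K 3 in
  X ^+ 4 + Y ^+ 4 + Z ^+ 4 + T ^+ 4
  - parF a b c d *: (X ^+ 2 * T ^+ 2 + Y ^+ 2 * Z ^+ 2)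
  - parG a b c d *: (X ^+ 2 * Z ^+ 2 + Y ^+ 2 * T ^+ 2)
  - parH a b c d *: (X ^+ 2 * Y ^+ 2 + Z ^+ 2 * T ^+ 2)
  + (2 * parE a b c d) *: (X * Y * Z * T).

(* Here f is the sextic (or quintic) of the genus 2 curve y ^ 2 = f(x). *)
Definition kummer_gen (K : fieldType) (f : {poly K}) : {mpoly K[4]} :=
  let k1 := proj_coord K 0 in let k2 := proj_coord K 1 in
  let k3 := proj_coord K 2 in let k4 := proj_coord K 3 in
  let f0 := (f`_0)%:MP_[4] in let f1 := (f`_1)%:MP_[4] in
  let f2 := (f`_2)%:MP_[4] in let f3 := (f`_3)%:MP_[4] in
  let f4 := (f`_4)%:MP_[4] in let f5 := (f`_5)%:MP_[4] in
  let f6 := (f`_6)%:MP_[4] in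
  let F1 := k2 ^+ 2 - 4 * k1 * k3 in
  let F2 := - 2 * (2 * k1 ^+ 3 * f0 + k1 ^+ 2 * k2 * f1
    + 2 * k1 ^+ 2 * k3 * f2 + k1 * k2 * k3 * f3 + 2 * k1 * k3 ^+ 2 * f4
    + k2 * k3 ^+ 2 * f5 + 2 * k3 ^+ 3 * f6) in
  let F3 := - 4 * k1 ^+ 4 * f0 * f2 + k1 ^+ 4 * f1 ^+ 2
    - 4 * k1 ^+ 3 * k2 * f0 * f3 - 2 * k1 ^+ 3 * k3 * f1 * f3
    - 4 * k1 ^+ 2 * k2 ^+ 2 * f0 * f4 + 4 * k1 ^+ 2 * k2 * k3 * f0 * f5
    - 4 * k1 ^+ 2 * k2 * k3 * f1 * f4 - 4 * k1 ^+ 2 * k3 ^+ 2 * f0 * f6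
    + 2 * k1 ^+ 2 * k3 ^+ 2 * f1 * f5 - 4 * k1 ^+ 2 * k3 ^+ 2 * f2 * f4
    + k1 ^+ 2 * k3 ^+ 2 * f3 ^+ 2 - 4 * k1 * k2 ^+ 3 * f0 * f5
    + 8 * k1 * k2 ^+ 2 * k3 * f0 * f6 - 4 * k2 ^+ 4 * f0 * f6
    - 4 * k1 * k2 ^+ 2 * k3 * f1 * f5 + 4 * k1 * k2 * k3 ^+ 2 * f1 * f6
    - 4 * k1 * k2 * k3 ^+ 2 * f2 * f5 - 2 * k1 * k3 ^+ 3 * f3 * f5
    - 4 * k2 ^+ 3 * k3 * f1 * f6 - 4 * k2 ^+ 2 * k3 ^+ 2 * f2 * f6
    - 4 * k2 * k3 ^+ 3 * f3 * f6 - 4 * k3 ^+ 4 * f4 * f6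
    + k3 ^+ 4 * f5 ^+ 2 in
  F1 * k4 ^+ 2 + F2 * k4 + F3.

(* p(M x), for the column x of the n variables *)
Definition subst_mx (K : fieldType) (n : nat) (M : 'M[K]_n)
    (p : {mpoly K[n]}) : {mpoly K[n]} :=
  comp_mpoly [tuple \sum_(j < n) M i j *: 'X_j | i < n] p.

(* The change of coordinates y = M x converts the equation p(x) = 0 into
   p(M^-1 y) = 0, which must be q(y) = 0 up to a nonzero constant. This is an
   identity of polynomials, not only of their values, since K may be finite. *)
Definition linear_map_of_surfaces (K : fieldType) (n : nat) (M : 'M[K]_n)
    (p q : {mpoly K[n]}) : Prop :=
  M \in unitmx /\
  exists lambda : K, lambda != 0 /\ subst_mx (invmx M) p = lambda *: q.

(* Main.v *)
Require Import Defs.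
From mathcomp Require Import all_boot all_algebra.
From mathcomp Require Import mpoly.
From mathcomp Require Import ring.

(* Since f_0 = f_6 = 0 and f_5 = 1, the General Kummer equation is
     Q1 ^ 2 - 4 k1 k3 Q2 = 0, where
     Q1 = k2 k4 - f_1 k1 ^ 2 + f_3 k1 k3 - k3 ^ 2 and
     Q2 = k4 ^ 2 + k4 (f_2 k1 + f_3 k2 + f_4 k3)
          + (k2 + f_4 k1) (f_1 k2 + f_2 k3).
   With N = n1 A B and M = n2 C D, the four rows of P are N ^ 2, 2 N, N M and
   2 M times low degree forms, and N ^ 2 f_1 = M ^ 2, N ^ 2 f_2 / M, N ^ 2 f_3
   and N f_4 are polynomials in a, b, c, d. Hence N ^ 2 M ^ 2 factors out of the
   transformed equation, which leaves a polynomial identity in a, b, c, d, X,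
   Y, Z, T; the total constant is
     - 256 N ^ 2 M ^ 2 dG dF ^ 3 dH ^ 3,
   where dF, dG, dH are the denominators of F, G, H. *)

Set Implicit Arguments.
Unset Strict Implicit.
Unset Printing Implicit Defensive.

Import GRing.Theory.
Local Open Scope ring_scope.

(** * Auxiliary algebra: 2 x 2 systems and the removal of denominators *)

Lemma linear_system2_eq0 (F : fieldType) (p q r s x y : F) :
  p * x + q * y = 0 -> r * x + s * y = 0 -> p * s - q * r != 0 ->
  x = 0 /\ y = 0.
Proof.
move=> eq1 eq2 det0; split; apply: (mulfI det0); rewrite mulr0.
  transitivity (s * (p * x + q * y) - q * (r * x + s * y)); first by ring.
  by rewrite eq1 eq2 !mulr0 subr0.
transitivity (p * (r * x + s * y) - r * (p * x + q * y)); first by ring.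
by rewrite eq1 eq2 !mulr0 subr0.
Qed.

(** [u], [l2], [v], [l4] are the low degree forms left in the rows of [P]. The denominators of the
    coefficients are absorbed by the powers of [N] in the coordinates, so nothing is ever divided
    and any commutative ring will do. *)
Lemma quintic_scaling (R : comNzRingType) (N M F1 F2 F3 F4 p2 p3 p4 : R)
    (u v l2 l4 : R) :
  N ^+ 2 * F1 = M ^+ 2 -> N ^+ 2 * F2 = - M * p2 -> N ^+ 2 * F3 = p3 ->
  N * F4 = - p4 ->
  let k0 := N ^+ 2 * u in let k1 := 2 * N * l2 in
  let k2 := N * M * v in let k3 := 2 * M * l4 in
  (k1 * k3 - F1 * k0 ^+ 2 + F3 * k0 * k2 - k2 ^+ 2) ^+ 2
  - 4 * k0 * k2 * (k3 ^+ 2 + k3 * (F2 * k0 + F3 * k1 + F4 * k2)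
                   + (k1 + F4 * k0) * (F1 * k1 + F2 * k2))
  = N ^+ 2 * M ^+ 2 * (
    (4 * l2 * l4 - N * M * (u ^+ 2 + v ^+ 2) + p3 * u * v) ^+ 2
    - 4 * u * v * (4 * (N * M) * (l2 ^+ 2 + l4 ^+ 2) + 4 * p3 * l2 * l4
       - 2 * (N * M) * (p4 * (u * l2 + v * l4) + p2 * (u * l4 + v * l2))
       + N * M * p2 * p4 * u * v)).
Proof.
move=> F1E F2E F3E F4E /=.
(* Regrouping makes each coefficient occur only inside the product that the corresponding hypothesis
   replaces. *)
transitivity (
  (4 * N * M * l2 * l4 - N ^+ 2 * F1 * N ^+ 2 * u ^+ 2
   + N ^+ 2 * F3 * N * M * u * v - N ^+ 2 * M ^+ 2 * v ^+ 2) ^+ 2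
  - 4 * N * M * u * v *
    (4 * N ^+ 2 * M ^+ 2 * l4 ^+ 2
     + 2 * M * l4 * (N ^+ 2 * F2 * N ^+ 2 * u + 2 * (N ^+ 2 * F3) * N * l2
                     + N * F4 * N ^+ 2 * M * v)
     + (2 * N * l2 + N * F4 * N * u)
       * (2 * (N ^+ 2 * F1) * N * l2 + N ^+ 2 * F2 * N * M * v))).
  by ring.
by rewrite F1E F2E F3E F4E; ring.
Qed.

(** * Non-degeneracy, the coefficients of the quintic, and invertibility of [P] *)

Section FastKummerMap.

Variables (K : fieldType) (a b c d : K).

Local Notation A := (parA a b c d).
Local Notation B := (parB a b c d).
Local Notation C := (parC a b c d).
Local Notation D := (parD a b c d).
Local Notation n1 := (n1 a b c d).
Local Notation n2 := (n2 a b c d).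

Definition denF : K := a ^+ 2 * d ^+ 2 - b ^+ 2 * c ^+ 2.
Definition denG : K := a ^+ 2 * c ^+ 2 - b ^+ 2 * d ^+ 2.
Definition denH : K := a ^+ 2 * b ^+ 2 - c ^+ 2 * d ^+ 2.

Definition scaleN : K := n1 * A * B.
Definition scaleM : K := n2 * C * D.
(* By curveD_poly_coef, f_2 = - scaleM * numf2 / scaleN ^+ 2,
   f_3 = numf3 / scaleN ^+ 2 and f_4 = - numf4 / scaleN. *)
Definition numf2 : K := n1 * (B * C + A * D) + n2 * (A * B + C * D).
Definition numf3 : K :=
  (n1 ^+ 2 + n2 ^+ 2) * (A * B * C * D)
  + n1 * n2 * (A * B + C * D) * (B * C + A * D).
Definition numf4 : K := n1 * (A * B + C * D) + n2 * (B * C + A * D).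

Local Notation m1 := (m1 a b c d).
Local Notation m2 := (m2 a b c d).
Local Notation m3 := (m3 a b c d).
Local Notation m4 := (m4 a b c d).

(** [C] and [D] divide the numerator of [rho], and [n2] that of [sigma]. The numerators of
    [sigma - 1], [tau - 1] and [rho - sigma] split into products containing all of [ab - cd],
    [ad - bc], [ab + cd] and [ad + bc], the factors of [denF] and [denH]. *)
Lemma nondegenerate_neq0 : nondegenerate_params a b c d ->
  [&& A != 0, B != 0, n1 != 0, C != 0, D != 0, n2 != 0, denF != 0
    & denH != 0].
Proof.
case/and4P => A0 B0 n10 /=; rewrite !inE !negb_or.
case/and5P => /and4P[_ rho0 sigma0 _] /and3P[_ sigma1 tau1].
case/andP => rho_sigma _ _ _.
have sigmaE : sigma a b c d
    = 1 + 2 * (a * b - c * d) * (a * d - b * c) / (n1 * A).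
  have -> : 2 * (a * b - c * d) * (a * d - b * c) = n2 * C - n1 * A.
    by rewrite /parA /parC /Defs.n1 /Defs.n2; ring.
  by rewrite /sigma; field; rewrite A0 n10.
have tauE : tau a b c d
    = 1 + 2 * (a * b + c * d) * (a * d - b * c) / (n1 * B).
  have -> : 2 * (a * b + c * d) * (a * d - b * c) = n2 * D - n1 * B.
    by rewrite /parB /parD /Defs.n1 /Defs.n2; ring.
  by rewrite /tau; field; rewrite B0 n10.
have rho_sigmaE : rho a b c d
    = sigma a b c d + 2 * (c * d - a * b) * (a * d + b * c) * C / (A * B * n1).
  have -> : 2 * (c * d - a * b) * (a * d + b * c) = D * n1 - n2 * B.
    by rewrite /parB /parD /Defs.n1 /Defs.n2; ring.
  by rewrite /rho /sigma; field; rewrite A0 B0 n10.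
have := rho0; rewrite eq_sym !mulf_eq0 !negb_or => /andP[/andP[C0 D0] _].
have := sigma0; rewrite eq_sym !mulf_eq0 !negb_or => /andP[/andP[n20 _] _].
have abm0 : a * b - c * d != 0.
  by apply: contra_neq sigma1 => z; rewrite sigmaE z !(mulr0, mul0r) addr0.
have adm0 : a * d - b * c != 0.
  by apply: contra_neq sigma1 => z; rewrite sigmaE z !(mulr0, mul0r) addr0.
have abp0 : a * b + c * d != 0.
  by apply: contra_neq tau1 => z; rewrite tauE z !(mulr0, mul0r) addr0.
have adp0 : a * d + b * c != 0.
  apply: contra_neq rho_sigma => z.
  by rewrite rho_sigmaE z !(mulr0, mul0r) addr0.
have -> : denF = (a * d - b * c) * (a * d + b * c) by rewrite /denF; ring.
have -> : denH = (a * b - c * d) * (a * b + c * d) by rewrite /denH; ring.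
by rewrite A0 B0 n10 C0 D0 n20 !mulf_neq0.
Qed.

Lemma n1_n2_denG : n1 * n2 = denG.
Proof. by rewrite /Defs.n1 /Defs.n2 /denG; ring. Qed.

Lemma coef_mulXsubC (R : nzRingType) (p : {poly R}) (x : R) i :
  (p * ('X - x%:P))`_i = (if i is j.+1 then p`_j else 0) - p`_i * x.
Proof. by rewrite mulrBr coefB coefMX coefMC; case: i. Qed.

Let f := curveD_poly a b c d.

(** The coefficients are signed elementary symmetric functions of 1, [rho], [sigma], [tau]; in
    particular [f_1 = rho sigma tau] is the square of [scaleM / scaleN]. *)
Lemma curveD_poly_coef : A != 0 -> B != 0 -> n1 != 0 ->
  [/\ f`_0 = 0, f`_5 = 1 & f`_6 = 0] /\
  [/\ scaleN ^+ 2 * f`_1 = scaleM ^+ 2,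
      scaleN ^+ 2 * f`_2 = - scaleM * numf2,
      scaleN ^+ 2 * f`_3 = numf3 & scaleN * f`_4 = - numf4].
Proof.
move=> A0 B0 n10.
(* Writing 1 as a constant polynomial gives every factor after ['X] the shape that [coef_mulXsubC]
   peels off. *)
have fE : f = 'X * ('X - 1%:P) * ('X - (rho a b c d)%:P)
    * ('X - (sigma a b c d)%:P) * ('X - (tau a b c d)%:P) by [].
rewrite fE !coef_mulXsubC !coefX /=.
rewrite /numf2 /numf3 /numf4 /scaleN /scaleM /rho /sigma /tau.
split; split; try ring; by field; rewrite ?A0 ?B0 ?n10.
Qed.

(** A row vector in the left kernel of [P] is shown to vanish by solving 2 x 2 systems twice: first
    for the combinations [y0] to [y3] of its entries, then for the entries. *)
Lemma matP_unit : 2%N \notin [pchar K] -> nondegenerate_params a b c d ->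
  matP a b c d \in unitmx.
Proof.
move=> hchar /nondegenerate_neq0.
case/and4P=> A0 B0 n10 /and5P[C0 D0 n20 F0 H0].
have two0 : 2 != 0 :> K by move: hchar; rewrite inE.
rewrite unitmxE unitfE; apply/det0P => -[v v0 vP].
have col j : \sum_(i < 4) v 0 i * matP a b c d i j = 0.
  by move/matrixP: vP => /(_ 0 j); rewrite !mxE.
have N0 : scaleN != 0 by rewrite !mulf_neq0.
have M0 : scaleM != 0 by rewrite !mulf_neq0.
have := (col 0, col 1, col (inord 2), col (inord 3)).
rewrite !big_ord_recl !big_ord0 !mxE !inordK //= !addr0.
set v_0 := v _ _; set v_1 := v _ _; set v_2 := v _ _; set v_3 := v _ _.
case=> -[[col0 col1] col2] col3.
(* The columns of P decouple: the 0th and 2nd involve only y0 and y1, the 1st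
   and 3rd only y2 and y3. *)
pose y0 := scaleN ^+ 2 * v_0 + scaleN * scaleM * v_2.
pose y1 := scaleN * v_1 + scaleM * v_3.
pose y2 := scaleN ^+ 2 * v_0 - scaleN * scaleM * v_2.
pose y3 := scaleN * v_1 - scaleM * v_3.
have {}col0 : c * y0 + 2 * a * m1 * y1 = 0.
  by rewrite -col0 /y0 /y1 /scaleN /scaleM; ring.
have {}col1 : - d * y2 + 2 * b * m2 * y3 = 0.
  by rewrite -col1 /y2 /y3 /scaleN /scaleM; ring.
have {}col2 : - a * y0 + - 2 * c * m3 * y1 = 0.
  by rewrite -col2 /y0 /y1 /scaleN /scaleM; ring.
have {}col3 : b * y2 + 2 * d * m4 * y3 = 0.
  by rewrite -col3 /y2 /y3 /scaleN /scaleM; ring.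
have det02 : c * (- 2 * c * m3) - 2 * a * m1 * - a = 4 * (- denF) * denH.
  by rewrite /denF /denH /Defs.m1 /Defs.m3; ring.
have det13 : - d * (2 * d * m4) - 2 * b * m2 * b = 4 * (- denF) * denH.
  by rewrite /denF /denH /Defs.m2 /Defs.m4; ring.
have det0 : 4 * (- denF) * denH != 0.
  have -> : 4 = 2 * 2 :> K by ring.
  by rewrite !mulf_neq0 ?oppr_eq0.
have [y0E y1E] : y0 = 0 /\ y1 = 0.
  by apply: linear_system2_eq0 col0 col2 _; rewrite det02.
have [y2E y3E] : y2 = 0 /\ y3 = 0.
  by apply: linear_system2_eq0 col1 col3 _; rewrite det13.
(* The [y]'s are sums and differences of the same two terms, which determine both terms because 2 is
   invertible. *)
have det_v (x y : K) : x != 0 -> y != 0 -> x * - y - y * x != 0.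
  move=> x_neq0 y_neq0; have -> : x * - y - y * x = - (2 * x * y) by ring.
  by rewrite oppr_eq0 !mulf_neq0.
have [v0E v2E] : v_0 = 0 /\ v_2 = 0.
  apply: (@linear_system2_eq0 _ (scaleN ^+ 2) (scaleN * scaleM)
    (scaleN ^+ 2) (- (scaleN * scaleM))).
  - by [].
  - by rewrite mulNr.
  - by rewrite det_v ?expf_neq0 ?mulf_neq0.
have [v1E v3E] : v_1 = 0 /\ v_3 = 0.
  apply: (@linear_system2_eq0 _ scaleN scaleM scaleN (- scaleM)).
  - by [].
  - by rewrite mulNr.
  - by rewrite det_v.
case/eqP: v0; apply/rowP => i; rewrite mxE.
case: i => [[|[|[|[|//]]]] ilt].
- by rewrite -[RHS]v0E; congr (v _ _); apply: val_inj.
- by rewrite -[RHS]v1E; congr (v _ _); apply: val_inj.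
- by rewrite -[RHS]v2E; congr (v _ _); apply: val_inj.
- by rewrite -[RHS]v3E; congr (v _ _); apply: val_inj.
Qed.

(** * The quartic identity, with coefficients from [K] and coordinates in [L] *)

Variables (L : comNzRingType) (phi : {rmorphism K -> L}) (X Y Z T : L).

(** Multiplying the Fast Kummer equation by [denG * denF ^+ 3 * denH ^+ 3 * - 256] clears the
    denominators of all its coefficients, so plain expansion decides the identity. *)
Lemma quartic_identity :
  let w1 := phi m1 in let w2 := phi m2 in
  let w3 := phi m3 in let w4 := phi m4 in
  let NM := phi (scaleN * scaleM) in
  let p2 := phi numf2 in let p3 := phi numf3 in let p4 := phi numf4 in
  let u := phi c * X - phi d * Y - phi a * Z + phi b * T in
  let v := phi c * X + phi d * Y - phi a * Z - phi b * T in
  let l2 := phi a * w1 * X + phi b * w2 * Y - phi c * w3 * Z + phi d * w4 * T in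
  let l4 := phi a * w1 * X - phi b * w2 * Y - phi c * w3 * Z - phi d * w4 * T in
  (4 * l2 * l4 - NM * (u ^+ 2 + v ^+ 2) + p3 * u * v) ^+ 2
  - 4 * u * v * (4 * NM * (l2 ^+ 2 + l4 ^+ 2) + 4 * p3 * l2 * l4
                 - 2 * NM * (p4 * (u * l2 + v * l4) + p2 * (u * l4 + v * l2))
                 + NM * p2 * p4 * u * v)
  = phi (denG * denF ^+ 3 * denH ^+ 3 * - 256)
      * (X ^+ 4 + Y ^+ 4 + Z ^+ 4 + T ^+ 4)
    - phi (denG * denF ^+ 2 * denH ^+ 3 * - 256
           * (a ^+ 4 - b ^+ 4 - c ^+ 4 + d ^+ 4))
      * (X ^+ 2 * T ^+ 2 + Y ^+ 2 * Z ^+ 2)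
    - phi (denF ^+ 3 * denH ^+ 3 * - 256
           * (a ^+ 4 - b ^+ 4 + c ^+ 4 - d ^+ 4))
      * (X ^+ 2 * Z ^+ 2 + Y ^+ 2 * T ^+ 2)
    - phi (denG * denF ^+ 3 * denH ^+ 2 * - 256
           * (a ^+ 4 + b ^+ 4 - c ^+ 4 - d ^+ 4))
      * (X ^+ 2 * Y ^+ 2 + Z ^+ 2 * T ^+ 2)
    + phi (denF ^+ 2 * denH ^+ 2 * - 256 * 2 * (a * b * c * d * A * B * C * D))
      * (X * Y * Z * T).
Proof.
rewrite /= /scaleN /scaleM /numf2 /numf3 /numf4 /denF /denG /denH.
rewrite /Defs.n1 /Defs.n2 /parA /parB /parC /parD.
rewrite /Defs.m1 /Defs.m2 /Defs.m3 /Defs.m4.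
by ring.
Qed.

(** The hypotheses on [k] say that it is [P] applied to [(X, Y, Z, T)], with the common factor of
    each row extracted. *)
Lemma quintic_identity (k : nat -> L) :
  nondegenerate_params a b c d ->
  let N := phi scaleN in let M := phi scaleM in
  let w1 := phi m1 in let w2 := phi m2 in
  let w3 := phi m3 in let w4 := phi m4 in
  k 0 = N ^+ 2 * (phi c * X - phi d * Y - phi a * Z + phi b * T) ->
  k 1 = 2 * N * (phi a * w1 * X + phi b * w2 * Y - phi c * w3 * Z
                 + phi d * w4 * T) ->
  k 2 = N * M * (phi c * X + phi d * Y - phi a * Z - phi b * T) ->
  k 3 = 2 * M * (phi a * w1 * X - phi b * w2 * Y - phi c * w3 * Z
                 - phi d * w4 * T) ->
  let F i := phi f`_i in
  (k 1 * k 3 - F 1 * k 0 ^+ 2 + F 3 * k 0 * k 2 - k 2 ^+ 2) ^+ 2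
  - 4 * k 0 * k 2 *
    (k 3 ^+ 2 + k 3 * (F 2 * k 0 + F 3 * k 1 + F 4 * k 2)
     + (k 1 + F 4 * k 0) * (F 1 * k 1 + F 2 * k 2))
  = phi (scaleN ^+ 2 * scaleM ^+ 2 * (denG * denF ^+ 3 * denH ^+ 3 * - 256)) *
    (X ^+ 4 + Y ^+ 4 + Z ^+ 4 + T ^+ 4
     - phi (parF a b c d) * (X ^+ 2 * T ^+ 2 + Y ^+ 2 * Z ^+ 2)
     - phi (parG a b c d) * (X ^+ 2 * Z ^+ 2 + Y ^+ 2 * T ^+ 2)
     - phi (parH a b c d) * (X ^+ 2 * Y ^+ 2 + Z ^+ 2 * T ^+ 2)
     + phi (2 * parE a b c d) * (X * Y * Z * T)).
Proof.
move=> hnd N M w1 w2 w3 w4 k0 k1 k2 k3 F.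
have := nondegenerate_neq0 hnd.
case/and4P=> A0 B0 n10 /and5P[C0 D0 n20 F0 H0].
have G0 : denG != 0 by rewrite -n1_n2_denG mulf_neq0.
have [_ [f1 f2 f3 f4]] := curveD_poly_coef A0 B0 n10.
have F1 : N ^+ 2 * F 1 = M ^+ 2 by rewrite /N /F -rmorphXn -rmorphM f1 rmorphXn.
have F2 : N ^+ 2 * F 2 = - M * phi numf2.
  by rewrite /N /F -rmorphXn -rmorphM f2 rmorphM rmorphN.
have F3 : N ^+ 2 * F 3 = phi numf3 by rewrite /N /F -rmorphXn -rmorphM f3.
have F4 : N * F 4 = - phi numf4 by rewrite /N /F -rmorphM f4 rmorphN.
have := quartic_identity; rewrite /= -/w1 -/w2 -/w3 -/w4.
set u := phi c * X - _ - _ + _ in k0 *; set v := phi c * X + _ - _ - _ in k2 *.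
set l2 := phi a * w1 * X + _ - _ + _ in k1 *.
set l4 := phi a * w1 * X - _ - _ - _ in k3 *.
move=> quarticE.
rewrite k0 k1 k2 k3 (quintic_scaling _ _ _ _ F1 F2 F3 F4).
rewrite -[N * M]rmorphM quarticE.
set lambda := _ * - 256.
have -> : phi (scaleN ^+ 2 * scaleM ^+ 2 * lambda)
    = N ^+ 2 * M ^+ 2 * phi lambda.
  by rewrite /N /M; ring.
rewrite -[RHS]mulrA; congr (_ * _).
(* Each cleared coefficient is recognized as [lambda] times a coefficient of the Fast Kummer
   equation, so that [phi lambda] factors out. *)
have -> : denG * denF ^+ 2 * denH ^+ 3 * - 256
    * (a ^+ 4 - b ^+ 4 - c ^+ 4 + d ^+ 4) = lambda * parF a b c d.
  by rewrite /lambda /parF -/denF; field.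
have -> : denF ^+ 3 * denH ^+ 3 * - 256
    * (a ^+ 4 - b ^+ 4 + c ^+ 4 - d ^+ 4) = lambda * parG a b c d.
  by rewrite /lambda /parG -/denG; field.
have -> : denG * denF ^+ 3 * denH ^+ 2 * - 256
    * (a ^+ 4 + b ^+ 4 - c ^+ 4 - d ^+ 4) = lambda * parH a b c d.
  by rewrite /lambda /parH -/denH; field.
have -> : denF ^+ 2 * denH ^+ 2 * - 256 * 2 * (a * b * c * d * A * B * C * D)
    = lambda * (2 * parE a b c d).
  rewrite /lambda /parE -/denF -/denG -/denH; field.
  by rewrite F0 G0 H0.
by rewrite !(rmorphM phi lambda); ring.
Qed.

End FastKummerMap.

(** * Substitution into the defining polynomials *)

Lemma subst_mx_kummer_gen (K : fieldType) (M : 'M[K]_4) (f : {poly K}) :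
  f`_0 = 0 -> f`_5 = 1 -> f`_6 = 0 ->
  let k i := subst_mx M (proj_coord K i) in let F i := (f`_i)%:MP_[4] in
  subst_mx M (kummer_gen f) =
    (k 1 * k 3 - F 1 * k 0 ^+ 2 + F 3 * k 0 * k 2 - k 2 ^+ 2) ^+ 2
    - 4 * k 0 * k 2 *
      (k 3 ^+ 2 + k 3 * (F 2 * k 0 + F 3 * k 1 + F 4 * k 2)
       + (k 1 + F 4 * k 0) * (F 1 * k 1 + F 2 * k 2)).
Proof.
move=> f0 f5 f6 k F.
have substF i : subst_mx M (F i) = F i by rewrite /subst_mx comp_mpolyC.
(* With the constants also written as images, both sides are expressions in images under one ring
   morphism. The indices 0 to 3 of [k] stand for [k_1] to [k_4]. *)
rewrite -(substF 1) -(substF 2) -(substF 3) -(substF 4).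
rewrite /k /kummer_gen f0 f5 f6 mpolyC0 mpolyC1 /F /subst_mx.
by ring.
Qed.

Lemma subst_mx_coord (K : fieldType) (M : 'M[K]_4) i :
  subst_mx M (proj_coord K i) =
  \sum_(j < 4) (M (inord i) (inord j))%:MP * proj_coord K j.
Proof.
rewrite /subst_mx comp_mpolyXU (nth_map (inord i)) ?size_enum_ord //.
rewrite nth_ord_enum; apply: eq_bigr => j _.
by rewrite /proj_coord inord_val mul_mpolyC.
Qed.

Lemma subst_mx_matP (K : fieldType) (a b c d : K) :
  let k i := subst_mx (matP a b c d) (proj_coord K i) in
  let phi := @mpolyC 4 K in
  let N := phi (scaleN a b c d) in let M := phi (scaleM a b c d) in
  let m1 := phi (m1 a b c d) in let m2 := phi (m2 a b c d) in
  let m3 := phi (m3 a b c d) in let m4 := phi (m4 a b c d) in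
  let X := proj_coord K 0 in let Y := proj_coord K 1 in
  let Z := proj_coord K 2 in let T := proj_coord K 3 in
  [/\ k 0 = N ^+ 2 * (phi c * X - phi d * Y - phi a * Z + phi b * T),
      k 1 = 2 * N * (phi a * m1 * X + phi b * m2 * Y - phi c * m3 * Z
                     + phi d * m4 * T),
      k 2 = N * M * (phi c * X + phi d * Y - phi a * Z - phi b * T)
    & k 3 = 2 * M * (phi a * m1 * X - phi b * m2 * Y - phi c * m3 * Z
                     - phi d * m4 * T)].
Proof.
move=> k phi N M m1 m2 m3 m4 X Y Z T.
split; rewrite /k subst_mx_coord !big_ord_recl big_ord0 !mxE !inordK //=.
all: rewrite /bump /N /M /m1 /m2 /m3 /m4 /phi /scaleN /scaleM /X /Y /Z /T /=.
all: ring.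
Qed.

Theorem theorem4p1 (K : fieldType) (hchar : 2%N \notin [pchar K])
    (a b c d : K) (hnd : nondegenerate_params a b c d) :
  matP a b c d \in unitmx /\
  linear_map_of_surfaces (invmx (matP a b c d))
    (kummer_gen (curveD_poly a b c d)) (kummer_fast a b c d).
Proof.
have Pu := matP_unit hchar hnd.
have two0 : 2 != 0 :> K by move: hchar; rewrite inE.
have := nondegenerate_neq0 hnd.
case/and4P=> A0 B0 n10 /and5P[C0 D0 n20 F0 H0].
have G0 : denG a b c d != 0 by rewrite -n1_n2_denG mulf_neq0.
split=> //; split; first by rewrite unitmx_inv.
set lambda := scaleN a b c d ^+ 2 * scaleM a b c d ^+ 2 *
  (denG a b c d * denF a b c d ^+ 3 * denH a b c d ^+ 3 * - 256).
exists lambda; split.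
  (* The constant is nonzero because 256 is a power of 2. *)
  rewrite /lambda; have -> : - 256 = - 2 ^+ 8 :> K by ring.
  by rewrite /scaleN /scaleM !mulf_neq0 ?oppr_eq0 ?expf_neq0 ?mulf_neq0.
(* Transporting the equation along the inverse of [P] substitutes [P] itself. *)
rewrite invmxK.
have [[f0 f5 f6] _] := curveD_poly_coef A0 B0 n10.
have [k0 k1 k2 k3] := subst_mx_matP a b c d.
pose k i := subst_mx (matP a b c d) (proj_coord K i).
rewrite subst_mx_kummer_gen //.
apply: etrans (quintic_identity (k := k) hnd k0 k1 k2 k3) _.
by rewrite /kummer_fast -!mul_mpolyC.
Qed.
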